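(* Let $H:\mathfrak g\to\mathfrak h$ be a crossed homomorphism from a Lie-Yamaguti algebra $(\mathfrak g,[\cdot,\cdot]_{\mathfrak g},[\![\cdot,\cdot,\cdot]\!]_{\mathfrak g})$ to another Lie-Yamaguti algebra $(\mathfrak h,[\cdot,\cdot]_{\mathfrak h},[\![\cdot,\cdot,\cdot]\!]_{\mathfrak h})$ with respect to an action $(\rho,\mu)$. Let $H_t=\sum_{i=0}^n\mathfrak H_it^i$ be an order $n$ deformation of $H$. Then $H_t$ is extendable if and only if the cohomology class $[\mathsf{Ob}^H]\in\mathcal H^2_H(\mathfrak g,\mathfrak h)$ is trivial, where $\mathsf{Ob}^H=(\mathsf{Ob}^H_{\rm I},\mathsf{Ob}^H_{\rm II})\in\mathfrak C^2_H(\mathfrak g,\mathfrak h)$ is defined by $$\mathsf{Ob}^H_{\rm I}(x_1,x_2)=\sum_{\substack{i+j=n+1\\0<i,j<n+1}}[\mathfrak H_ix_1,\mathfrak H_jx_2]_{\mathfrak h},\qquad \mathsf{Ob}^H_{\rm II}(x_1,x_2,x_3)=\sum_{\substack{i+j+k=n+1\\0<i,j,k<n+1}}[\![\mathfrak H_ix_1,\mathfrak H_jx_2,\mathfrak H_kx_3]\!]_{\mathfrak h}$$ for all $x_1,x_2,x_3\in\mathfrak g$.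
   Context: All vector spaces are finite-dimensional over a field $\mathbb K$ of characteristic $0$; $n\ge1$ is an integer. A Lie-Yamaguti algebra is a vector space $\mathfrak g$ with a bilinear bracket $[\cdot,\cdot]:\wedge^2\mathfrak g\to\mathfrak g$ and a trilinear bracket $[\![\cdot,\cdot,\cdot]\!]:\wedge^2\mathfrak g\otimes\mathfrak g\to\mathfrak g$ (skew-symmetric in the first two arguments) such that for all $x,y,z,w,t\in\mathfrak g$: (1) $[[x,y],z]+[[y,z],x]+[[z,x],y]+[\![x,y,z]\!]+[\![y,z,x]\!]+[\![z,x,y]\!]=0$; (2) $[\![[x,y],z,w]\!]+[\![[y,z],x,w]\!]+[\![[z,x],y,w]\!]=0$; (3) $[\![x,y,[z,w]]\!]=[[\![x,y,z]\!],w]+[z,[\![x,y,w]\!]]$; (4) $[\![x,y,[\![z,w,t]\!]]\!]=[\![[\![x,y,z]\!],w,t]\!]+[\![z,[\![x,y,w]\!],t]\!]+[\![z,w,[\![x,y,t]\!]]\!]$. A representation of $\mathfrak g$ on a vector space $V$ is a linear map $\rho:\mathfrak g\to\mathfrak{gl}(V)$ and a bilinear map $\mu:\otimes^2\mathfrak g\to\mathfrak{gl}(V)$ such that, with $D(x,y)=D_{\rho,\mu}(x,y):=\mu(y,x)-\mu(x,y)+[\rho(x),\rho(y)]-\rho([x,y])$, for all $x,y,z,w\in\mathfrak g$: $\mu([x,y],z)-\mu(x,z)\rho(y)+\mu(y,z)\rho(x)=0$; $\mu(x,[y,z])-\rho(y)\mu(x,z)+\rho(z)\mu(x,y)=0$;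 $\rho([\![x,y,z]\!])=[D(x,y),\rho(z)]$; $\mu(z,w)\mu(x,y)-\mu(y,w)\mu(x,z)-\mu(x,[\![y,z,w]\!])+D(y,z)\mu(x,w)=0$; $\mu([\![x,y,z]\!],w)+\mu(z,[\![x,y,w]\!])=[D(x,y),\mu(z,w)]$. The center of $\mathfrak h$ is $C(\mathfrak h):=\{u:[u,v]=0\ \forall v\}\cap\big(\{u:[\![u,v,w]\!]=0\ \forall v,w\}\cup\{u:[\![v,u,w]\!]=0\ \forall v,w\}\big)$. An action of $\mathfrak g$ on $\mathfrak h$ is a representation $(\rho,\mu)$ of $\mathfrak g$ on the vector space $\mathfrak h$ such that for all $x,y\in\mathfrak g$, $u,v,w\in\mathfrak h$: $\rho(x)u,\ \mu(x,y)u\in C(\mathfrak h)$; $\rho(x)[u,v]_{\mathfrak h}=\mu(x,y)[u,v]_{\mathfrak h}=0$; $\rho(x)[\![u,v,w]\!]_{\mathfrak h}=\mu(x,y)[\![u,v,w]\!]_{\mathfrak h}=0$. A crossed homomorphism from $\mathfrak g$ to $\mathfrak h$ with respect to $(\rho,\mu)$ is a linear map $H:\mathfrak g\to\mathfrak h$ such that for all $x,y,z\in\mathfrak g$: $H[x,y]_{\mathfrak g}=\rho(x)H(y)-\rho(y)H(x)+[Hx,Hy]_{\mathfrak h}$ and $H[\![x,y,z]\!]_{\mathfrak g}=D(x,y)H(z)+\mu(y,z)H(x)-\mu(x,z)H(y)+[\![Hx,Hy,Hz]\!]_{\mathfrak h}$. An order $n$ deformation of $H$ is $H_t=\sum_{i=0}^n\mathfrak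 H_it^i$ with $\mathfrak H_0=H$, $\mathfrak H_i\in\mathrm{Hom}_{\mathbb K}(\mathfrak g,\mathfrak h)$, regarded as a $\mathbb K[t]/(t^{n+1})$-module map $\mathfrak g[t]/(t^{n+1})\to\mathfrak h[t]/(t^{n+1})$, such that for all $x,y,z\in\mathfrak g$, in $\mathfrak h[t]/(t^{n+1})$ (all structure maps extended $\mathbb K[t]/(t^{n+1})$-multilinearly): $H_t[x,y]_{\mathfrak g}=\rho(x)(H_ty)-\rho(y)(H_tx)+[H_tx,H_ty]_{\mathfrak h}$ and $H_t[\![x,y,z]\!]_{\mathfrak g}=D(x,y)(H_tz)+\mu(y,z)(H_tx)-\mu(x,z)(H_ty)+[\![H_tx,H_ty,H_tz]\!]_{\mathfrak h}$. It is extendable if there is $\mathfrak H_{n+1}\in\mathrm{Hom}_{\mathbb K}(\mathfrak g,\mathfrak h)$ such that $H_t+\mathfrak H_{n+1}t^{n+1}$ is an order $n+1$ deformation of $H$. Second cohomology group of $H$: let $\rho_H(x)u=[Hx,u]_{\mathfrak h}+\rho(x)u$, $\mu_H(x,y)u=[\![u,Hx,Hy]\!]_{\mathfrak h}+\mu(x,y)u$, $D_H(x,y)u=[\![Hx,Hy,u]\!]_{\mathfrak h}+D(x,y)u$. Cochains: $\mathfrak C^1_H(\mathfrak g,\mathfrak h)=\mathrm{Hom}(\mathfrak g,\mathfrak h)$ and $\mathfrak C^2_H(\mathfrak g,\mathfrak h)=\mathrm{Hom}(\wedge^2\mathfrak g,\mathfrak h)\times\mathrm{Hom}(\wedge^2\mathfrak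 g\otimes\mathfrak g,\mathfrak h)$. For $f\in\mathfrak C^1_H$, $\delta^Hf=(\delta^H_{\rm I}f,\delta^H_{\rm II}f)\in\mathfrak C^2_H$ with $\delta^H_{\rm I}(f)(x,y)=\rho_H(x)f(y)-\rho_H(y)f(x)-f([x,y]_{\mathfrak g})$, $\delta^H_{\rm II}(f)(x,y,z)=D_H(x,y)f(z)+\mu_H(y,z)f(x)-\mu_H(x,z)f(y)-f([\![x,y,z]\!]_{\mathfrak g})$. For $(f,g)\in\mathfrak C^2_H$, $\mathfrak X_i=x_i\wedge y_i$ and $\mathfrak X_1\circ\mathfrak X_2=[\![x_1,y_1,x_2]\!]_{\mathfrak g}\wedge y_2+x_2\wedge[\![x_1,y_1,y_2]\!]_{\mathfrak g}$, $\delta^H(f,g)=(\delta^H_{\rm I}(f,g),\delta^H_{\rm II}(f,g))$ with $$\delta^H_{\rm I}(f,g)(\mathfrak X_1,\mathfrak X_2)=-\rho_H(x_2)g(\mathfrak X_1,y_2)+\rho_H(y_2)g(\mathfrak X_1,x_2)+g(\mathfrak X_1,[x_2,y_2]_{\mathfrak g})+D_H(\mathfrak X_1)f(\mathfrak X_2)-f(\mathfrak X_1\circ\mathfrak X_2),$$ $$\delta^H_{\rm II}(f,g)(\mathfrak X_1,\mathfrak X_2,z)=-\mu_H(y_2,z)g(\mathfrak X_1,x_2)+\mu_H(x_2,z)g(\mathfrak X_1,y_2)+D_H(\mathfrak X_1)g(\mathfrak X_2,z)-D_H(\mathfrak X_2)g(\mathfrak X_1,z)$$ $$-g(\mathfrak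 X_1\circ\mathfrak X_2,z)-g(\mathfrak X_2,[\![x_1,y_1,z]\!]_{\mathfrak g})+g(\mathfrak X_1,[\![x_2,y_2,z]\!]_{\mathfrak g}).$$ $\mathcal H^2_H(\mathfrak g,\mathfrak h)=\ker(\delta^H|_{\mathfrak C^2_H})/\delta^H(\mathfrak C^1_H)$; a class is trivial when its representative lies in $\delta^H(\mathfrak C^1_H)$.
   Formalization: In Ob_II the sum runs over i+j+k=n+1 with 0≤i,j,k<n+1 instead of 0<i,j,k<n+1 (terms with one index 0 are kept); with the printed range the claim is false, e.g. for n=1, H e1=a, H_1 e2=b, [[a,b,b]]=c. That Ob is a 2-cocycle is proved too. *)

(* Defs.v *)
From HB Require Import structures.
From mathcomp Require Import all_boot all_order all_algebra.

Set Implicit Arguments.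
Unset Strict Implicit.
Unset Printing Implicit Defensive.

Import GRing.Theory.
Local Open Scope ring_scope.

(* Multilinear maps are curried iterated homs: 'Hom(U, 'Hom(V, W)) is the     *)
(* space of bilinear maps U x V -> W, and 'End(V) = 'Hom(V, V) is gl(V).      *)

Section LieYamaguti.
Variable K : fieldType.

Record lieYamaguti (g : vectType K) := LieYamaguti {
  br : 'Hom(g, 'Hom(g, g));
  tbr : 'Hom(g, 'Hom(g, 'Hom(g, g)));
  br_alt : forall x, br x x = 0;
  tbr_alt : forall x z, tbr x x z = 0;
  ly_cyclic : forall x y z,
    br (br x y) z + br (br y z) x + br (br z x) y
    + tbr x y z + tbr y z x + tbr z x y = 0;
  ly_tbr_br : forall x y z w,
    tbr (br x y) z w + tbr (br y z) x w + tbr (br z x) y w = 0;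
  ly_deriv_br : forall x y z w,
    tbr x y (br z w) = br (tbr x y z) w + br z (tbr x y w);
  ly_deriv_tbr : forall x y z w t,
    tbr x y (tbr z w t)
    = tbr (tbr x y z) w t + tbr z (tbr x y w) t + tbr z w (tbr x y t)
}.

Definition commf (V : vectType K) (a b : 'End(V)) : 'End(V) :=
  (a \o b)%VF - (b \o a)%VF.

Definition Dmap (g V : vectType K) (L : lieYamaguti g)
    (rho : 'Hom(g, 'End(V))) (mu : 'Hom(g, 'Hom(g, 'End(V)))) (x y : g) :
    'End(V) :=
  mu y x - mu x y + commf (rho x) (rho y) - rho (br L x y).

Record representation (g : vectType K) (L : lieYamaguti g) (V : vectType K) :=
  Representation {
  rho : 'Hom(g, 'End(V));
  mu : 'Hom(g, 'Hom(g, 'End(V)));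
  rep_mu_brl : forall x y z,
    mu (br L x y) z - (mu x z \o rho y)%VF + (mu y z \o rho x)%VF = 0;
  rep_mu_brr : forall x y z,
    mu x (br L y z) - (rho y \o mu x z)%VF + (rho z \o mu x y)%VF = 0;
  rep_rho_tbr : forall x y z,
    rho (tbr L x y z) = commf (Dmap L rho mu x y) (rho z);
  rep_mu_mu : forall x y z w,
    (mu z w \o mu x y)%VF - (mu y w \o mu x z)%VF - mu x (tbr L y z w)
    + (Dmap L rho mu y z \o mu x w)%VF = 0;
  rep_mu_tbr : forall x y z w,
    mu (tbr L x y z) w + mu z (tbr L x y w)
    = commf (Dmap L rho mu x y) (mu z w)
}.

Definition Drep (g : vectType K) (L : lieYamaguti g) (V : vectType K)
    (r : representation L V) (x y : g) : 'End(V) :=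
  Dmap L (rho r) (mu r) x y.

Definition in_center (h : vectType K) (M : lieYamaguti h) (u : h) : Prop :=
  (forall v, br M u v = 0) /\
  ((forall v w, tbr M u v w = 0) \/ (forall v w, tbr M v u w = 0)).

Record action (g h : vectType K) (L : lieYamaguti g) (M : lieYamaguti h) :=
  Action {
  act_rep :> representation L h;
  act_rho_center : forall x u, in_center M (rho act_rep x u);
  act_mu_center : forall x y u, in_center M (mu act_rep x y u);
  act_rho_br : forall x u v, rho act_rep x (br M u v) = 0;
  act_mu_br : forall x y u v, mu act_rep x y (br M u v) = 0;
  act_rho_tbr : forall x u v w, rho act_rep x (tbr M u v w) = 0;
  act_mu_tbr : forall x y u v w, mu act_rep x y (tbr M u v w) = 0
}.

(* V[t]/(t^(n+1)), an element sum_(k <= n) v_k t^k being given by its         *)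
(* coefficients; ext1, ext2, ext3 are the K[t]/(t^(n+1))-multilinear          *)
(* extensions of linear, bilinear and trilinear maps.                         *)
Definition trunc (n : nat) (V : vectType K) := {ffun 'I_n.+1 -> V}.

Section Extension.
Variables (n : nat) (U V W X : vectType K).

Definition ext1 (f : 'Hom(U, X)) (u : trunc n U) : trunc n X :=
  [ffun k => f (u k)].

Definition ext2 (f : 'Hom(U, 'Hom(V, X))) (u : trunc n U) (v : trunc n V) :
    trunc n X :=
  [ffun k : 'I_n.+1 =>
    \sum_(i < n.+1) \sum_(j < n.+1 | (i + j == k)%N) f (u i) (v j)].

Definition ext3 (f : 'Hom(U, 'Hom(V, 'Hom(W, X))))
    (u : trunc n U) (v : trunc n V) (w : trunc n W) : trunc n X :=
  [ffun k : 'I_n.+1 =>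
    \sum_(i < n.+1) \sum_(j < n.+1) \sum_(l < n.+1 | (i + j + l == k)%N)
      f (u i) (v j) (w l)].

(* The value at a constant x of the K[t]/(t^(n+1))-linear map                 *)
(* sum_(i <= n) Ht_i t^i; the defining equations of a deformation only        *)
(* evaluate it at constants.                                                  *)
Definition tapp (Ht : {ffun 'I_n.+1 -> 'Hom(U, X)}) (x : U) : trunc n X :=
  [ffun k => Ht k x].

End Extension.

Section CrossedHom.
Variables (g h : vectType K) (L : lieYamaguti g) (M : lieYamaguti h).
Variable r : action L M.

Definition crossed_hom (H : 'Hom(g, h)) : Prop :=
  (forall x y,
     H (br L x y) = rho r x (H y) - rho r y (H x) + br M (H x) (H y)) /\
  (forall x y z,
     H (tbr L x y z)
     = Drep r x y (H z) + mu r y z (H x) - mu r x z (H y)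
       + tbr M (H x) (H y) (H z)).

Definition deformation (n : nat) (H : 'Hom(g, h))
    (Ht : {ffun 'I_n.+1 -> 'Hom(g, h)}) : Prop :=
  [/\ Ht ord0 = H,
    forall x y,
      tapp Ht (br L x y)
      = ext1 (rho r x) (tapp Ht y) - ext1 (rho r y) (tapp Ht x)
        + ext2 (br M) (tapp Ht x) (tapp Ht y)
    & forall x y z,
      tapp Ht (tbr L x y z)
      = ext1 (Drep r x y) (tapp Ht z) + ext1 (mu r y z) (tapp Ht x)
        - ext1 (mu r x z) (tapp Ht y)
        + ext3 (tbr M) (tapp Ht x) (tapp Ht y) (tapp Ht z)].

(* Ht + f t^(n+1) *)
Definition add_top (n : nat) (Ht : {ffun 'I_n.+1 -> 'Hom(g, h)})
    (f : 'Hom(g, h)) : {ffun 'I_n.+2 -> 'Hom(g, h)} :=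
  [ffun i : 'I_n.+2 => oapp Ht f (unlift ord_max i)].

Definition extendable (n : nat) (H : 'Hom(g, h))
    (Ht : {ffun 'I_n.+1 -> 'Hom(g, h)}) : Prop :=
  exists f : 'Hom(g, h), deformation H (add_top Ht f).

Section Cohomology.
Variable H : 'Hom(g, h).

Definition rhoH (x : g) (u : h) : h := br M (H x) u + rho r x u.
Definition muH (x y : g) (u : h) : h := tbr M u (H x) (H y) + mu r x y u.
Definition DH (x y : g) (u : h) : h := tbr M (H x) (H y) u + Drep r x y u.

(* A pair (f, g) lies in Hom(/\^2 g, h) x Hom(/\^2 g (x) g, h). *)
Definition cochain2 (c1 : g -> g -> h) (c2 : g -> g -> g -> h) : Prop :=
  [/\ forall y, linear (c1^~ y),
      forall x, linear (c1 x)
    & forall x, c1 x x = 0] /\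
  [/\ forall y z, linear (fun x => c2 x y z),
      forall x z, linear (fun y => c2 x y z),
      forall x y, linear (c2 x y)
    & forall x z, c2 x x z = 0].

Definition delta1_I (f : 'Hom(g, h)) (x y : g) : h :=
  rhoH x (f y) - rhoH y (f x) - f (br L x y).

Definition delta1_II (f : 'Hom(g, h)) (x y z : g) : h :=
  DH x y (f z) + muH y z (f x) - muH x z (f y) - f (tbr L x y z).

Definition delta2_I (c1 : g -> g -> h) (c2 : g -> g -> g -> h)
    (x1 y1 x2 y2 : g) : h :=
  - rhoH x2 (c2 x1 y1 y2) + rhoH y2 (c2 x1 y1 x2) + c2 x1 y1 (br L x2 y2)
  + DH x1 y1 (c1 x2 y2)
  - (c1 (tbr L x1 y1 x2) y2 + c1 x2 (tbr L x1 y1 y2)).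

Definition delta2_II (c2 : g -> g -> g -> h) (x1 y1 x2 y2 z : g) : h :=
  - muH y2 z (c2 x1 y1 x2) + muH x2 z (c2 x1 y1 y2)
  + DH x1 y1 (c2 x2 y2 z) - DH x2 y2 (c2 x1 y1 z)
  - (c2 (tbr L x1 y1 x2) y2 z + c2 x2 (tbr L x1 y1 y2) z)
  - c2 x2 y2 (tbr L x1 y1 z) + c2 x1 y1 (tbr L x2 y2 z).

(* Membership in ker(delta | C^2), i.e. (c1, c2) has a class in H^2. *)
Definition cocycle2 (c1 : g -> g -> h) (c2 : g -> g -> g -> h) : Prop :=
  [/\ cochain2 c1 c2,
      forall x1 y1 x2 y2, delta2_I c1 c2 x1 y1 x2 y2 = 0
    & forall x1 y1 x2 y2 z, delta2_II c2 x1 y1 x2 y2 z = 0].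

(* Membership in delta(C^1), i.e. the class of (c1, c2) in H^2 is trivial. *)
Definition coboundary2 (c1 : g -> g -> h) (c2 : g -> g -> g -> h) : Prop :=
  exists f : 'Hom(g, h),
    (forall x y, c1 x y = delta1_I f x y) /\
    (forall x y z, c2 x y z = delta1_II f x y z).

End Cohomology.
End CrossedHom.

Section Obstruction.
Variables (n : nat) (g h : vectType K) (M : lieYamaguti h).
Variable Ht : {ffun 'I_n.+1 -> 'Hom(g, h)}.

Definition Ob_I (x1 x2 : g) : h :=
  \sum_(i < n.+1) \sum_(j < n.+1 | [&& (0 < i)%N, (0 < j)%N & (i + j == n.+1)%N])
    br M (Ht i x1) (Ht j x2).

(* The t^(n+1)-coefficient of [[Ht x1, Ht x2, Ht x3]]: no index is n+1, but   *)
(* ONE index may be 0.  (In Ob_I the condition 0 < i, j is automatic.)  If    *)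
(* the sum is restricted to 0 < i, j, k < n+1, terms such as                  *)
(* [[Ht_0 x1, Ht_1 x2, Ht_n x3]] are lost and the extension criterion fails:  *)
(* let g = <e1, e2> be abelian, h = <a, b, c> with [[a, b, b]] = c =          *)
(* - [[b, a, b]] and all other brackets of basis vectors 0, rho = 0, mu = 0,  *)
(* Ht_0 = (e1 |-> a, e2 |-> 0), Ht_1 = (e1 |-> 0, e2 |-> b) and n = 1; the    *)
(* restricted sum is 0, but Ht is not extendable.                             *)
Definition Ob_II (x1 x2 x3 : g) : h :=
  \sum_(i < n.+1) \sum_(j < n.+1) \sum_(k < n.+1 | (i + j + k == n.+1)%N)
    tbr M (Ht i x1) (Ht j x2) (Ht k x3).

End Obstruction.
End LieYamaguti.

(* Main.v *)
Require Import Defs.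
From HB Require Import structures.
From mathcomp Require Import all_boot all_order all_algebra.
From mathcomp Require Import ring.

Set Implicit Arguments.
Unset Strict Implicit.
Unset Printing Implicit Defensive.

Import GRing.Theory.
Local Open Scope ring_scope.

(** Extending Ht by f t^(n+1) changes only the coefficient of t^(n+1) in the
    defining equations of a deformation, where it asks that the obstruction Ob
    be minus the coboundary of f ([deformation_add_top]). Hence the extension
    exists exactly when Ob is a coboundary, and the real content is that Ob is
    a cocycle.

    The cocycle property is a Bianchi identity. For any linear map T from g to
    h, crossed or not, let [curv_I] and [curv_II] measure its failure to be a
    crossed homomorphism. The action makes g x h a Lie-Yamaguti algebra, the
    semidirect product, whose two derivation identities are [semi_deriv_br] and
    [semi_deriv_tbr]. The brackets of points of the graph of T leave the graph
    exactly by the curvature of T, so the derivation identities, read on the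
    graph, say that the curvature is killed by the
    coboundary operator twisted by T ([bianchi_I], [bianchi_II]). No quadratic
    term in the curvature survives, because each term of the derivation
    identities contains a single inner bracket.

    Now replace t by a scalar s. The map T_s = sum_i s^i Ht_i ([eval_at]) is a
    linear map from g to h, and since Ht is a deformation its curvature is
    s^(n+1) F_s, where F_s ([tail_I], [tail_II]) is polynomial in s and
    F_0 = Ob. For s <> 0, dividing the Bianchi identity of T_s by s^(n+1) shows
    that the T_s-twisted coboundary of F_s is zero. It is polynomial in s and
    the field is infinite, so it is zero at s = 0 as well
    ([polynomial_curve_divX]), where it is the H-twisted coboundary of Ob. The
    alternating property of Ob follows in the same way from that of the
    curvature. *)

(** * Vectors, linear forms and multilinear maps *)

Lemma scalar_ext (K : fieldType) (V : vectType K) (u v : V) :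
  (forall phi : {scalar V}, phi u = phi v) -> u = v.
Proof.
move=> eq_uv; rewrite (coord_vbasis (memvf u)) (coord_vbasis (memvf v)).
by apply: eq_bigr => i _; rewrite eq_uv.
Qed.

(** Over the scalars an identity between sums of vectors is one that [ring]
    can decide; [phi] ranges over all linear forms. *)
Ltac linear_ring :=
  let phi := fresh "phi" in
  apply: scalar_ext; intro phi;
  rewrite !(linearD phi, linearN phi, linear0 phi) /=; ring.

Section Multilinear.
Variables (K : fieldType) (U V W X : vectType K).

Lemma lfun2D (f : 'Hom(U, 'Hom(V, W))) x y z : f (x + y) z = f x z + f y z.
Proof. by rewrite linearD; exact: add_lfunE. Qed.

Lemma lfun2N (f : 'Hom(U, 'Hom(V, W))) x z : f (- x) z = - f x z.
Proof. by rewrite linearN; exact: opp_lfunE. Qed.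

Lemma lfun3D1 (f : 'Hom(U, 'Hom(V, 'Hom(W, X)))) x y z w :
  f (x + y) z w = f x z w + f y z w.
Proof. by rewrite linearD (add_lfunE (f x)); exact: (add_lfunE (f x z)). Qed.

Lemma lfun3D2 (f : 'Hom(V, 'Hom(U, 'Hom(W, X)))) x y z w :
  f z (x + y) w = f z x w + f z y w.
Proof. by rewrite linearD; exact: (add_lfunE (f z x)). Qed.

Lemma lfun3N1 (f : 'Hom(U, 'Hom(V, 'Hom(W, X)))) x z w :
  f (- x) z w = - f x z w.
Proof. by rewrite linearN (opp_lfunE (f x)); exact: (opp_lfunE (f x z)). Qed.

Section Sums.
Variables (I : Type) (s : seq I) (P : pred I) (F : I -> U).

Lemma lfun2_sum (f : 'Hom(U, 'Hom(V, W))) y :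
  f (\sum_(i <- s | P i) F i) y = \sum_(i <- s | P i) f (F i) y.
Proof. by rewrite linear_sum; exact: sum_lfunE. Qed.

Lemma lfun3_sum1 (f : 'Hom(U, 'Hom(V, 'Hom(W, X)))) y z :
  f (\sum_(i <- s | P i) F i) y z = \sum_(i <- s | P i) f (F i) y z.
Proof.
by rewrite linear_sum (sum_lfunE _ _ (fun i => f (F i))); exact: sum_lfunE.
Qed.

Lemma lfun3_sum2 (f : 'Hom(V, 'Hom(U, 'Hom(W, X)))) y z :
  f y (\sum_(i <- s | P i) F i) z = \sum_(i <- s | P i) f y (F i) z.
Proof. by rewrite linear_sum; exact: sum_lfunE. Qed.

End Sums.

Lemma lfun2Z (f : 'Hom(U, 'Hom(V, W))) a x y : f (a *: x) y = a *: f x y.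
Proof. by rewrite linearZ; exact: scale_lfunE. Qed.

Lemma lfun3Z1 (f : 'Hom(U, 'Hom(V, 'Hom(W, X)))) a x y z :
  f (a *: x) y z = a *: f x y z.
Proof. by rewrite linearZ (scale_lfunE a (f x)); exact: scale_lfunE. Qed.

Lemma lfun3Z2 (f : 'Hom(V, 'Hom(U, 'Hom(W, X)))) a x y z :
  f y (a *: x) z = a *: f y x z.
Proof. by rewrite linearZ; exact: scale_lfunE. Qed.

End Multilinear.

(** * Polynomial curves over a field of characteristic zero *)

Section PolynomialCurves.
Variable K : fieldType.

(** Repeated degrees are allowed in the list of monomials, so that a product is
    given by all pairs of monomials and no convolution has to be formed. *)
Definition polynomial_curve (V : vectType K) (P : K -> V) : Prop :=
  exists l : seq (nat * V), forall s, P s = \sum_(p <- l) s ^+ p.1 *: p.2.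

Section Closure.
Variables U V : vectType K.

Lemma polynomial_curve_const (v : V) : polynomial_curve (fun=> v).
Proof. by exists [:: (0%N, v)] => s; rewrite big_seq1 expr0 scale1r. Qed.

Lemma polynomial_curveD (P Q : K -> V) :
  polynomial_curve P -> polynomial_curve Q ->
  polynomial_curve (fun s => P s + Q s).
Proof.
by move=> [l Pl] [m Qm]; exists (l ++ m) => s; rewrite big_cat /= Pl Qm.
Qed.

Lemma polynomial_curveX k (P : K -> V) :
  polynomial_curve P -> polynomial_curve (fun s => s ^+ k *: P s).
Proof.
move=> [l Pl]; exists [seq ((k + p.1)%N, p.2) | p <- l] => s.
rewrite Pl scaler_sumr big_map; apply: eq_bigr => p _.
by rewrite scalerA exprD.
Qed.

Lemma polynomial_curve_sum (I : Type) (r : seq I) (A : pred I)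
    (P : I -> K -> V) :
  (forall i, polynomial_curve (P i)) ->
  polynomial_curve (fun s => \sum_(i <- r | A i) P i s).
Proof.
move=> polyP; elim: r => [|i r [l sl]].
  by exists [::] => s; rewrite !big_nil.
have [m sm] := polyP i.
exists (if A i then m ++ l else l) => s; rewrite big_cons sl.
by case: (A i) => //; rewrite big_cat /= sm.
Qed.

Lemma polynomial_curve_app (f : K -> 'Hom(U, V)) (P : K -> U) :
  polynomial_curve f -> polynomial_curve P ->
  polynomial_curve (fun s => f s (P s)).
Proof.
move=> [l fl] [m Pm].
exists [seq ((p.1 + q.1)%N, (p.2 : 'Hom(U, V)) q.2) | p <- l, q <- m] => s.
rewrite big_allpairs_dep fl Pm sum_lfunE; apply: eq_bigr => p _.
rewrite linear_sum; apply: eq_bigr => q _ /=.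
by rewrite scale_lfunE linearZ scalerA exprD.
Qed.

Lemma polynomial_curveN (P : K -> V) :
  polynomial_curve P -> polynomial_curve (fun s => - P s).
Proof.
move=> [l Pl]; exists [seq (p.1, - p.2) | p <- l] => s.
by rewrite Pl big_map -sumrN; apply: eq_bigr => p _; rewrite scalerN.
Qed.

End Closure.

Hypothesis charK : [pchar K] =i pred0.

(** In characteristic zero 1, 2, 3 and so on are infinitely many distinct
    nonzero roots. *)
Lemma poly0_of_nonzero_roots (p : {poly K}) :
  (forall s, s != 0 -> p.[s] = 0) -> p = 0.
Proof.
move=> p0; apply/eqP/idPn => /max_poly_roots.
pose rs := [seq i.+1%:R : K | i <- iota 0 (size p)].
have natr_inj i j : (i%:R == j%:R :> K) = (i == j).
  wlog le_ij: i j / (i <= j)%N.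
    move=> W; case/orP: (leq_total i j); first exact: W.
    by rewrite eq_sym (eq_sym i); apply: W.
  rewrite eq_sym -subr_eq0 -natrB // ((pcharf0P K).1 charK) subn_eq0.
  by rewrite [in RHS]eqn_leq le_ij.
move=> /(_ rs); rewrite size_map size_iota ltnn.
have -> : uniq rs.
  rewrite map_inj_uniq ?iota_uniq // => i j /eqP.
  by rewrite natr_inj => /eqP[].
have -> : all (root p) rs.
  apply/allP => _ /mapP[i _ ->]; apply/eqP/p0.
  by rewrite ((pcharf0P K).1 charK).
by move=> /(_ isT isT).
Qed.

(** In each linear coordinate P is the evaluation of a polynomial, which is
    determined by its values at nonzero points. *)
Lemma polynomial_curve_at0 (V : vectType K) (P : K -> V) :
  polynomial_curve P -> (forall s, s != 0 -> P s = 0) -> P 0 = 0.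
Proof.
move=> [l Pl] P0; apply: scalar_ext => phi; rewrite linear0.
pose p : {poly K} := \sum_(q <- l) phi q.2 *: 'X^(q.1).
have pE s : p.[s] = phi (P s).
  rewrite Pl linear_sum /p horner_sum; apply: eq_bigr => q _.
  by rewrite linearZ /= hornerZ hornerXn mulrC.
rewrite -pE (@poly0_of_nonzero_roots p) ?horner0 // => s /P0 Ps0.
by rewrite pE Ps0 linear0.
Qed.

End PolynomialCurves.

(** * Lie-Yamaguti algebras and their centers *)

Section LieYamagutiBasics.
Variables (K : fieldType) (g : vectType K) (L : lieYamaguti g).

Lemma brC x y : br L x y = - br L y x.
Proof.
apply/eqP; rewrite -addr_eq0; apply/eqP.
have := br_alt L (x + y).
by rewrite lfun2D !linearD /= !br_alt add0r addr0.
Qed.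

Lemma tbrC x y z : tbr L x y z = - tbr L y x z.
Proof.
apply/eqP; rewrite -addr_eq0; apply/eqP.
have := tbr_alt L (x + y) z.
by rewrite lfun3D1 !lfun3D2 !tbr_alt add0r addr0.
Qed.

Lemma center_brl u v : in_center L u -> br L u v = 0.
Proof. by case. Qed.

Lemma center_brr u v : in_center L u -> br L v u = 0.
Proof. by case=> u0 _; rewrite brC u0 oppr0. Qed.

Lemma center_tbr1 u v w : in_center L u -> tbr L u v w = 0.
Proof. by case=> _ [] u0; rewrite ?u0 // tbrC u0 oppr0. Qed.

Lemma center_tbr2 u v w : in_center L u -> tbr L v u w = 0.
Proof. by move=> /center_tbr1 u0; rewrite tbrC u0 oppr0. Qed.

Lemma center_tbr3 u v w : in_center L u -> tbr L v w u = 0.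
Proof.
move=> Cu; have := ly_cyclic L v w u.
rewrite (center_tbr1 _ _ Cu) (center_tbr2 _ _ Cu) !addr0.
rewrite (center_brr _ Cu) (center_brr w Cu) (center_brl v Cu).
by rewrite linear0 !zero_lfunE !add0r.
Qed.

Lemma centerD u v : in_center L u -> in_center L v -> in_center L (u + v).
Proof.
move=> Cu Cv; split=> [w|].
  by rewrite lfun2D !center_brl // addr0.
by left=> w t; rewrite lfun3D1 !center_tbr1 // addr0.
Qed.

Lemma centerN u : in_center L u -> in_center L (- u).
Proof.
move=> Cu; split=> [w|].
  by rewrite lfun2N !center_brl // oppr0.
by left=> w t; rewrite lfun3N1 !center_tbr1 // oppr0.
Qed.

Lemma br_centerDl u v w : in_center L u -> br L (u + v) w = br L v w.
Proof. by move=> Cu; rewrite lfun2D center_brl // add0r. Qed.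

Lemma br_centerDr u v w : in_center L u -> br L w (u + v) = br L w v.
Proof. by move=> Cu; rewrite linearD /= center_brr // add0r. Qed.

Lemma tbr_centerD1 u v w t : in_center L u -> tbr L (u + v) w t = tbr L v w t.
Proof. by move=> Cu; rewrite lfun3D1 center_tbr1 // add0r. Qed.

Lemma tbr_centerD2 u v w t : in_center L u -> tbr L w (u + v) t = tbr L w v t.
Proof. by move=> Cu; rewrite lfun3D2 center_tbr2 // add0r. Qed.

Lemma tbr_centerD3 u v w t : in_center L u -> tbr L w t (u + v) = tbr L w t v.
Proof. by move=> Cu; rewrite linearD /= center_tbr3 // add0r. Qed.

End LieYamagutiBasics.

(** * Representations, evaluated at vectors *)

Lemma DrepE (K : fieldType) (g V : vectType K) (L : lieYamaguti g)
    (r : representation L V) x y u :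
  Drep r x y u
  = mu r y x u - mu r x y u + rho r x (rho r y u) - rho r y (rho r x u)
    - rho r (br L x y) u.
Proof.
by rewrite /Drep /Dmap /commf !(add_lfunE, opp_lfunE, comp_lfunE) !addrA.
Qed.

(* Opacity only keeps the matching of nested applications of linear maps
   syntactic: unfolding them while looking for an instance is very slow. *)
Local Opaque Drep fun_of_lfun.

Section Representation.
Variables (K : fieldType) (g V : vectType K) (L : lieYamaguti g).
Variable r : representation L V.

Lemma Drep_alt x u : Drep r x x u = 0.
Proof.
by rewrite DrepE br_alt linear0 zero_lfunE subrr add0r subrr subr0.
Qed.

Lemma mu_brrE x y z u :
  mu r x (br L y z) u = rho r y (mu r x z u) - rho r z (mu r x y u).
Proof.
have := rep_mu_brr r x y z => /(congr1 (fun f : 'End(V) => f u)).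
rewrite !(add_lfunE, opp_lfunE, comp_lfunE, zero_lfunE) => /eqP.
by rewrite addr_eq0 subr_eq addrC => /eqP.
Qed.

Lemma rho_tbrE x y z u :
  rho r (tbr L x y z) u = Drep r x y (rho r z u) - rho r z (Drep r x y u).
Proof.
by rewrite [rho r _]rep_rho_tbr /commf !(add_lfunE, opp_lfunE, comp_lfunE).
Qed.

Lemma mu_tbr_rE x y z w u :
  mu r x (tbr L y z w) u
  = mu r z w (mu r x y u) - mu r y w (mu r x z u) + Drep r y z (mu r x w u).
Proof.
have := rep_mu_mu r x y z w => /(congr1 (fun f : 'End(V) => f u)).
rewrite !(add_lfunE, opp_lfunE, comp_lfunE, zero_lfunE) => /eqP.
by rewrite addrAC subr_eq0 => /eqP.
Qed.

Lemma mu_tbr_lE x y z w u :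
  mu r (tbr L x y z) w u
  = Drep r x y (mu r z w u) - mu r z w (Drep r x y u) - mu r z (tbr L x y w) u.
Proof.
have := rep_mu_tbr r x y z w => /(congr1 (fun f : 'End(V) => f u)).
rewrite /commf !(add_lfunE, opp_lfunE, comp_lfunE) => <-.
by rewrite addrK.
Qed.

(** Like [rho_tbrE] and [mu_tbr_lE], this says that D x y acts on operators as
    the derivation induced by the ternary bracket; as D is built from mu, rho
    and the binary bracket, it follows from those two and [ly_deriv_br]. *)
Lemma Drep_tbr x y z w u :
  Drep r (tbr L x y z) w u
  = Drep r x y (Drep r z w u) - Drep r z w (Drep r x y u)
    - Drep r z (tbr L x y w) u.
Proof.
have brE : rho r (br L (tbr L x y z) w) u
   = rho r (tbr L x y (br L z w)) u - rho r (br L z (tbr L x y w)) u.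
  by rewrite ly_deriv_br linearD add_lfunE addrK.
rewrite (DrepE r (tbr L x y z) w) brE !(rho_tbrE x y) !(mu_tbr_lE x y z).
rewrite !(DrepE r z w) !(DrepE r z (tbr L x y w)).
rewrite !(rho_tbrE x y w) !(mu_tbr_lE x y w).
linear_ring.
Qed.

End Representation.

(** * The derivation identities of the semidirect product *)

Section Semidirect.
Variables (K : fieldType) (g h : vectType K).
Variables (L : lieYamaguti g) (M : lieYamaguti h) (r : action L M).

Definition semi_br (X Y : g * h) : g * h :=
  (br L X.1 Y.1, rho r X.1 Y.2 - rho r Y.1 X.2 + br M X.2 Y.2).

Definition semi_tbr (X Y Z : g * h) : g * h :=
  (tbr L X.1 Y.1 Z.1,
   Drep r X.1 Y.1 Z.2 + mu r Y.1 Z.1 X.2 - mu r X.1 Z.1 Y.2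
   + tbr M X.2 Y.2 Z.2).

Lemma Drep_act_br x y u v : Drep r x y (br M u v) = 0.
Proof. by rewrite DrepE !(act_rho_br, act_mu_br, linear0, subr0, addr0). Qed.

Lemma Drep_act_tbr x y u v w : Drep r x y (tbr M u v w) = 0.
Proof. by rewrite DrepE !(act_rho_tbr, act_mu_tbr, linear0, subr0, addr0). Qed.

Lemma Drep_center x y u : in_center M (Drep r x y u).
Proof.
have Crho a b : in_center M (rho r a b) by apply: act_rho_center.
have Cmu a b c : in_center M (mu r a b c) by apply: act_mu_center.
by rewrite DrepE; do ![apply: centerD | apply: centerN].
Qed.

Lemma semi_br_center x y u v : in_center M (rho r x u - rho r y v).
Proof. by apply: centerD; [|apply: centerN]; apply: act_rho_center. Qed.

Lemma semi_tbr_center x y z u v w :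
  in_center M (Drep r x y w + mu r y z u - mu r x z v).
Proof.
apply: centerD; last by apply: centerN; apply: act_mu_center.
by apply: centerD; [apply: Drep_center | apply: act_mu_center].
Qed.

(** The images of the action are central and the action kills all brackets of
    h, so every mixed term, in which the action meets a bracket of h, drops out
    of this identity and the next. What remains holds in g, in h, and for the
    representation. *)
Lemma semi_deriv_br X Y Z W :
  semi_tbr X Y (semi_br Z W)
  = semi_br (semi_tbr X Y Z) W + semi_br Z (semi_tbr X Y W).
Proof.
case: X Y Z W => [x a] [y b] [z c] [w d]; congr pair => /=.
  exact: ly_deriv_br.
rewrite (tbr_centerD3 _ _ _ (semi_br_center _ _ _ _)).
rewrite (br_centerDl _ _ (semi_tbr_center _ _ _ _ _ _)).
rewrite (br_centerDr _ _ (semi_tbr_center _ _ _ _ _ _)).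
rewrite (linearD (Drep r x y)) (linearB (Drep r x y)) /= Drep_act_br.
rewrite !(linearD (rho r w), linearN (rho r w)) /= act_rho_tbr.
rewrite !(linearD (rho r z), linearN (rho r z)) /= act_rho_tbr.
rewrite (rho_tbrE r x y z) (rho_tbrE r x y w) !(mu_brrE r _ z w) ly_deriv_br.
linear_ring.
Qed.

Lemma semi_deriv_tbr X Y Z W T :
  semi_tbr X Y (semi_tbr Z W T)
  = semi_tbr (semi_tbr X Y Z) W T + semi_tbr Z (semi_tbr X Y W) T
    + semi_tbr Z W (semi_tbr X Y T).
Proof.
case: X Y Z W T => [x a] [y b] [z c] [w d] [t e]; congr pair => /=.
  exact: ly_deriv_tbr.
rewrite !(tbr_centerD3 _ _ _ (semi_tbr_center _ _ _ _ _ _)).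
rewrite (tbr_centerD1 _ _ _ (semi_tbr_center _ _ _ _ _ _)).
rewrite (tbr_centerD2 _ _ _ (semi_tbr_center _ _ _ _ _ _)).
rewrite !(linearD (Drep r x y), linearN (Drep r x y)) /= Drep_act_tbr.
rewrite !(linearD (Drep r z w), linearN (Drep r z w)) /= Drep_act_tbr.
rewrite !(linearD (mu r w t), linearN (mu r w t)) /= act_mu_tbr.
rewrite !(linearD (mu r z t), linearN (mu r z t)) /= act_mu_tbr.
rewrite ly_deriv_tbr (Drep_tbr r x y z w).
rewrite (mu_tbr_rE r x z w t) (mu_tbr_rE r y z w t).
rewrite (mu_tbr_lE r x y z t) (mu_tbr_lE r x y w t).
linear_ring.
Qed.

End Semidirect.

(** * Curvature and its Bianchi identities *)

Section Bianchi.
Variables (K : fieldType) (g h : vectType K).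
Variables (L : lieYamaguti g) (M : lieYamaguti h) (r : action L M).
Variable T : 'Hom(g, h).

Definition curv_I (x y : g) : h :=
  rho r x (T y) - rho r y (T x) + br M (T x) (T y) - T (br L x y).

Definition curv_II (x y z : g) : h :=
  Drep r x y (T z) + mu r y z (T x) - mu r x z (T y)
  + tbr M (T x) (T y) (T z) - T (tbr L x y z).

Lemma semi_br_graph x y :
  semi_br r (x, T x) (y, T y) = (br L x y, T (br L x y) + curv_I x y).
Proof. by congr pair; rewrite /curv_I /= [RHS]addrC subrK. Qed.

(** An error e of one argument off the graph propagates, to the binary and
    ternary brackets, exactly through the operators twisted by T. *)
Lemma semi_br_graphDl p y e :
  semi_br r (p, T p + e) (y, T y)
  = (br L p y, T (br L p y) + curv_I p y - rhoH r T y e).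
Proof.
congr pair; rewrite /curv_I /rhoH /=.
rewrite lfun2D (linearD (rho r y)) (brC M e) /=.
linear_ring.
Qed.

Lemma semi_br_graphDr x p e :
  semi_br r (x, T x) (p, T p + e)
  = (br L x p, T (br L x p) + curv_I x p + rhoH r T x e).
Proof.
congr pair; rewrite /curv_I /rhoH /=.
rewrite (linearD (br M (T x))) (linearD (rho r x)) /=.
linear_ring.
Qed.

Lemma semi_tbr_graph x y z :
  semi_tbr r (x, T x) (y, T y) (z, T z)
  = (tbr L x y z, T (tbr L x y z) + curv_II x y z).
Proof. by congr pair; rewrite /curv_II /= [RHS]addrC subrK. Qed.

Lemma semi_tbr_graphD1 p y z e :
  semi_tbr r (p, T p + e) (y, T y) (z, T z)
  = (tbr L p y z, T (tbr L p y z) + curv_II p y z + muH r T y z e).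
Proof.
congr pair; rewrite /curv_II /muH /=.
rewrite lfun3D1 (linearD (mu r y z)) /=.
linear_ring.
Qed.

Lemma semi_tbr_graphD2 x p z e :
  semi_tbr r (x, T x) (p, T p + e) (z, T z)
  = (tbr L x p z, T (tbr L x p z) + curv_II x p z - muH r T x z e).
Proof.
congr pair; rewrite /curv_II /muH /=.
rewrite lfun3D2 (linearD (mu r x z)) (tbrC M e) /=.
linear_ring.
Qed.

Lemma semi_tbr_graphD3 x y p e :
  semi_tbr r (x, T x) (y, T y) (p, T p + e)
  = (tbr L x y p, T (tbr L x y p) + curv_II x y p + DH r T x y e).
Proof.
congr pair; rewrite /curv_II /DH /=.
rewrite (linearD (tbr M (T x) (T y))) (linearD (Drep r x y)) /=.
linear_ring.
Qed.

(** This is the h-component of [semi_deriv_br] at four points of the graph of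
    T; the terms in the image of T cancel by [ly_deriv_br] in g. *)
Lemma bianchi_I x1 y1 x2 y2 : delta2_I r T curv_I curv_II x1 y1 x2 y2 = 0.
Proof.
have := semi_deriv_br r (x1, T x1) (y1, T y1) (x2, T x2) (y2, T y2).
rewrite semi_br_graph !semi_tbr_graph semi_tbr_graphD3.
rewrite semi_br_graphDl semi_br_graphDr => /(congr1 snd) /=.
rewrite ly_deriv_br (linearD T) /= => /eqP; rewrite -subr_eq0 => /eqP <-.
rewrite /delta2_I.
linear_ring.
Qed.

(** The same reading of [semi_deriv_tbr] at five points of the graph. *)
Lemma bianchi_II x1 y1 x2 y2 z : delta2_II r T curv_II x1 y1 x2 y2 z = 0.
Proof.
have := semi_deriv_tbr r (x1, T x1) (y1, T y1) (x2, T x2) (y2, T y2) (z, T z).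
rewrite !semi_tbr_graph !semi_tbr_graphD3 semi_tbr_graphD1 semi_tbr_graphD2.
move=> /(congr1 snd) /=.
rewrite ly_deriv_tbr !(linearD T) /= => /eqP; rewrite -subr_eq0 => /eqP <-.
rewrite /delta2_II.
linear_ring.
Qed.

Lemma curv_I_alt x : curv_I x x = 0.
Proof. by rewrite /curv_I !br_alt linear0 subrr add0r subrr. Qed.

Lemma curv_II_alt x z : curv_II x x z = 0.
Proof.
by rewrite /curv_II !tbr_alt Drep_alt linear0 add0r subrr add0r subrr.
Qed.

End Bianchi.

(** * Deformations as polynomial families of linear maps *)

Section Homogeneity.
Variables (K : fieldType) (g h : vectType K).
Variables (L : lieYamaguti g) (M : lieYamaguti h) (r : action L M).
Variables (T : 'Hom(g, h)) (a : K).

Lemma rhoHZ x u : rhoH r T x (a *: u) = a *: rhoH r T x u.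
Proof. by rewrite /rhoH !linearZ /= scalerDr. Qed.

Lemma muHZ x y u : muH r T x y (a *: u) = a *: muH r T x y u.
Proof.
rewrite /muH scalerDr (linearZ_LR (mu r x y)) /=; congr (_ + _).
by rewrite tbrC (linearZ_LR (tbr M (T x))) scale_lfunE /= -scalerN -tbrC.
Qed.

Lemma DHZ x y u : DH r T x y (a *: u) = a *: DH r T x y u.
Proof. by rewrite /DH !linearZ /= scalerDr. Qed.

Lemma delta2_IZ c1 c2 x1 y1 x2 y2 :
  delta2_I r T (fun x y => a *: c1 x y) (fun x y z => a *: c2 x y z)
    x1 y1 x2 y2
  = a *: delta2_I r T c1 c2 x1 y1 x2 y2.
Proof.
by rewrite /delta2_I !(rhoHZ, DHZ) -!scalerN -!scalerDr -scalerN -scalerDr.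
Qed.

Lemma delta2_IIZ c2 x1 y1 x2 y2 z :
  delta2_II r T (fun x y z => a *: c2 x y z) x1 y1 x2 y2 z
  = a *: delta2_II r T c2 x1 y1 x2 y2 z.
Proof.
by rewrite /delta2_II !(muHZ, DHZ) -!scalerN -!scalerDr -!scalerN -!scalerDr.
Qed.

End Homogeneity.

Lemma sum_by_degree (K : fieldType) (V : lmodType K) (I : finType)
    (w : I -> nat) (F : I -> V) (s : K) n :
  \sum_i s ^+ w i *: F i
  = \sum_(m < n) s ^+ m *: (\sum_(i | (w i == m)%N) F i)
    + s ^+ n *: (\sum_(i | (n <= w i)%N) s ^+ (w i - n) *: F i).
Proof.
rewrite (bigID (fun i => (n <= w i)%N)) [LHS]addrC /=.
congr (_ + _); last first.
  rewrite scaler_sumr; apply: eq_bigr => i le_n.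
  by rewrite scalerA -exprD subnKC.
under [RHS]eq_bigr do rewrite scaler_sumr.
rewrite (exchange_big_dep (fun i => (w i < n)%N)) => [|m i _ /eqP -> //] /=.
apply: eq_big => [i|i]; first by rewrite ltnNge.
rewrite -ltnNge => lt_n; rewrite (big_pred1 (Ordinal lt_n)) //.
Qed.

Section Deformation.
Variables (K : fieldType) (g h : vectType K).
Variables (L : lieYamaguti g) (M : lieYamaguti h) (r : action L M).
Variables (n : nat) (Ht : {ffun 'I_n.+1 -> 'Hom(g, h)}).

Definition eval_at (s : K) : 'Hom(g, h) := \sum_(i < n.+1) s ^+ i *: Ht i.

Lemma eval_atE s x : eval_at s x = \sum_(i < n.+1) s ^+ i *: Ht i x.
Proof.
by rewrite /eval_at sum_lfunE; apply: eq_bigr => i _; rewrite scale_lfunE.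
Qed.

Lemma lfun_eval_at (f : 'End(h)) s x :
  f (eval_at s x) = \sum_(i < n.+1) s ^+ i *: f (Ht i x).
Proof.
by rewrite eval_atE linear_sum; apply: eq_bigr => i _; rewrite linearZ.
Qed.

Lemma eval_at0 : eval_at 0 = Ht ord0.
Proof.
rewrite /eval_at big_ord_recl expr0 scale1r big1 ?addr0 // => i _.
by rewrite exprS mul0r scale0r.
Qed.

Definition deg2 (p : 'I_n.+1 * 'I_n.+1) := (p.1 + p.2)%N.
Definition deg3 (p : 'I_n.+1 * ('I_n.+1 * 'I_n.+1)) := (p.1 + p.2.1 + p.2.2)%N.

(** The part of degree at least n+1 in s of the brackets of the values of
    [eval_at s], divided by s^(n+1). *)
Definition tail_I (s : K) (x y : g) : h :=
  \sum_(p | (n.+1 <= deg2 p)%N)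
    s ^+ (deg2 p - n.+1) *: br M (Ht p.1 x) (Ht p.2 y).

Definition tail_II (s : K) (x y z : g) : h :=
  \sum_(p | (n.+1 <= deg3 p)%N)
    s ^+ (deg3 p - n.+1) *: tbr M (Ht p.1 x) (Ht p.2.1 y) (Ht p.2.2 z).

Lemma br_eval_at s x y :
  br M (eval_at s x) (eval_at s y)
  = \sum_(p : 'I_n.+1 * 'I_n.+1) s ^+ deg2 p *: br M (Ht p.1 x) (Ht p.2 y).
Proof.
rewrite !eval_atE lfun2_sum -(pair_bigA _ (fun i j : 'I_n.+1 =>
  s ^+ (i + j) *: br M (Ht i x) (Ht j y))) /=.
apply: eq_bigr => i _; rewrite lfun2Z linear_sum scaler_sumr.
by apply: eq_bigr => j _; rewrite linearZ scalerA exprD.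
Qed.

Lemma tbr_eval_at s x y z :
  tbr M (eval_at s x) (eval_at s y) (eval_at s z)
  = \sum_(p : 'I_n.+1 * ('I_n.+1 * 'I_n.+1))
      s ^+ deg3 p *: tbr M (Ht p.1 x) (Ht p.2.1 y) (Ht p.2.2 z).
Proof.
rewrite !eval_atE lfun3_sum1.
rewrite -(pair_bigA _ (fun (i : 'I_n.+1) (q : 'I_n.+1 * 'I_n.+1) =>
  s ^+ (i + q.1 + q.2) *: tbr M (Ht i x) (Ht q.1 y) (Ht q.2 z))) /=.
apply: eq_bigr => i _; rewrite lfun3Z1 lfun3_sum2.
rewrite -(pair_bigA _ (fun j k : 'I_n.+1 =>
  s ^+ (i + j + k) *: tbr M (Ht i x) (Ht j y) (Ht k z))) /= scaler_sumr.
apply: eq_bigr => j _; rewrite lfun3Z2 linear_sum /= !scaler_sumr.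
by apply: eq_bigr => k _; rewrite scalerA linearZ /= scalerA !exprD.
Qed.

Lemma sum_deg2 (F : 'I_n.+1 -> 'I_n.+1 -> h) m :
  \sum_(i < n.+1) \sum_(j < n.+1 | (i + j == m)%N) F i j
  = \sum_(p | (deg2 p == m)%N) F p.1 p.2.
Proof. by rewrite pair_big_dep. Qed.

Lemma sum_deg3 (F : 'I_n.+1 -> 'I_n.+1 -> 'I_n.+1 -> h) m :
  \sum_(i < n.+1) \sum_(j < n.+1) \sum_(k < n.+1 | (i + j + k == m)%N) F i j k
  = \sum_(p | (deg3 p == m)%N) F p.1 p.2.1 p.2.2.
Proof. by under eq_bigr do rewrite pair_big_dep; rewrite pair_big_dep. Qed.

(** At s = 0 only the terms of exact degree m survive, since 0 ^+ 0 = 1. *)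
Lemma sum_expr0_degree (I : finType) (w : I -> nat) (F : I -> h) m :
  \sum_(i | (m <= w i)%N) (0 : K) ^+ (w i - m) *: F i
  = \sum_(i | (w i == m)%N) F i.
Proof.
rewrite (bigID (fun i => w i == m)) /= [X in _ + X]big1 => [|i].
  rewrite addr0; apply: eq_big => [i | i /andP[_ /eqP ->]].
    by rewrite andb_idl // => /eqP ->.
  by rewrite subnn scale1r.
move=> /andP[le_m neq_m]; rewrite expr0n subn_eq0 leqNgt.
by rewrite ltn_neqAle le_m eq_sym neq_m scale0r.
Qed.

Lemma tail_I0 x y : tail_I 0 x y = Ob_I M Ht x y.
Proof.
rewrite /tail_I sum_expr0_degree.
rewrite -(sum_deg2 (fun i j => br M (Ht i x) (Ht j y))).
apply: eq_bigr => i _; apply: eq_bigl => j.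
case: eqP => [ij|]; last by rewrite !andbF.
(* An index 0 would force the other one to be n+1, which is out of range. *)
have := ltn_ord i; have := ltn_ord j.
case: (val i) (val j) ij => [|i'] [|j'] //=; rewrite ?addn0 ?add0n => -> //.
  by rewrite ltnn.
by move=> _; rewrite ltnn.
Qed.

Lemma tail_II0 x y z : tail_II 0 x y z = Ob_II M Ht x y z.
Proof.
rewrite /tail_II sum_expr0_degree.
by rewrite -(sum_deg3 (fun i j k => tbr M (Ht i x) (Ht j y) (Ht k z))).
Qed.

Section Curvature.
Variable H : 'Hom(g, h).
Hypothesis defHt : deformation r H Ht.

(** The equations of a deformation say that the coefficients of degree at most
    n of the curvature vanish, and only the brackets have terms of higher
    degree. *)
Lemma curv_I_eval_at s x y :
  curv_I r (eval_at s) x y = s ^+ n.+1 *: tail_I s x y.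
Proof.
have [_ eqI _] := defHt.
rewrite /curv_I br_eval_at !lfun_eval_at.
rewrite (sum_by_degree deg2 _ _ n.+1) eval_atE.
rewrite -/(tail_I s x y) addrA [LHS]addrAC -[RHS]add0r; congr (_ + _).
apply/eqP; rewrite subr_eq0 -sumrB eq_sym; apply/eqP.
rewrite -[RHS]big_split /=; apply: eq_bigr => m _.
have /ffunP/(_ m) := eqI x y; rewrite !ffunE => ->.
rewrite scalerDr scalerBr; congr (_ + _ *: _).
rewrite -(sum_deg2 (fun i j => br M (Ht i x) (Ht j y))).
by apply: eq_bigr => i _; apply: eq_bigr => j _; rewrite !ffunE.
Qed.

Lemma curv_II_eval_at s x y z :
  curv_II r (eval_at s) x y z = s ^+ n.+1 *: tail_II s x y z.
Proof.
have [_ _ eqII] := defHt.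
rewrite /curv_II tbr_eval_at !lfun_eval_at.
rewrite (sum_by_degree deg3 _ _ n.+1) eval_atE.
rewrite -/(tail_II s x y z) addrA [LHS]addrAC -[RHS]add0r; congr (_ + _).
apply/eqP; rewrite subr_eq0 eq_sym; apply/eqP.
rewrite -big_split -sumrB -[RHS]big_split /=.
apply: eq_bigr => m _.
have /ffunP/(_ m) := eqII x y z; rewrite !ffunE => ->.
rewrite scalerDr scalerBr scalerDr; congr (_ + _ *: _).
rewrite -(sum_deg3 (fun i j k => tbr M (Ht i x) (Ht j y) (Ht k z))).
apply: eq_bigr => i _; apply: eq_bigr => j _; apply: eq_bigr => k _.
by rewrite !ffunE.
Qed.

End Curvature.

Lemma polynomial_curve_eval_at x : polynomial_curve (fun s => eval_at s x).
Proof.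
apply: polynomial_curve_app; last exact: polynomial_curve_const.
apply: polynomial_curve_sum => i.
by apply: polynomial_curveX; apply: polynomial_curve_const.
Qed.

Lemma polynomial_curve_tail_I x y : polynomial_curve (fun s => tail_I s x y).
Proof.
apply: polynomial_curve_sum => p.
by apply: polynomial_curveX; apply: polynomial_curve_const.
Qed.

Lemma polynomial_curve_tail_II x y z :
  polynomial_curve (fun s => tail_II s x y z).
Proof.
apply: polynomial_curve_sum => p.
by apply: polynomial_curveX; apply: polynomial_curve_const.
Qed.

Lemma polynomial_curve_lfun (f : 'End(h)) (P : K -> h) :
  polynomial_curve P -> polynomial_curve (fun s => f (P s)).
Proof. by apply: polynomial_curve_app; apply: polynomial_curve_const. Qed.

Lemma polynomial_curve_br (P Q : K -> h) :
  polynomial_curve P -> polynomial_curve Q ->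
  polynomial_curve (fun s => br M (P s) (Q s)).
Proof.
move=> polP; apply: polynomial_curve_app.
by apply: polynomial_curve_app polP; apply: polynomial_curve_const.
Qed.

Lemma polynomial_curve_tbr (P Q R : K -> h) :
  polynomial_curve P -> polynomial_curve Q -> polynomial_curve R ->
  polynomial_curve (fun s => tbr M (P s) (Q s) (R s)).
Proof.
move=> polP polQ; apply: polynomial_curve_app.
apply: polynomial_curve_app polQ.
by apply: polynomial_curve_app polP; apply: polynomial_curve_const.
Qed.

Lemma polynomial_curve_rhoH x (P : K -> h) :
  polynomial_curve P -> polynomial_curve (fun s => rhoH r (eval_at s) x (P s)).
Proof.
move=> polP; apply: polynomial_curveD; last exact: polynomial_curve_lfun.
by apply: polynomial_curve_br polP; apply: polynomial_curve_eval_at.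
Qed.

Lemma polynomial_curve_muH x y (P : K -> h) :
  polynomial_curve P ->
  polynomial_curve (fun s => muH r (eval_at s) x y (P s)).
Proof.
move=> polP; apply: polynomial_curveD; last exact: polynomial_curve_lfun.
by apply: polynomial_curve_tbr => //; apply: polynomial_curve_eval_at.
Qed.

Lemma polynomial_curve_DH x y (P : K -> h) :
  polynomial_curve P ->
  polynomial_curve (fun s => DH r (eval_at s) x y (P s)).
Proof.
move=> polP; apply: polynomial_curveD; last exact: polynomial_curve_lfun.
by apply: polynomial_curve_tbr => //; apply: polynomial_curve_eval_at.
Qed.

End Deformation.

(** * The obstruction is a cocycle *)

Section Cocycle.
Variables (K : fieldType) (charK : [pchar K] =i pred0).
Variables (g h : vectType K).
Variables (L : lieYamaguti g) (M : lieYamaguti h) (r : action L M).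
Variables (n : nat) (Ht : {ffun 'I_n.+1 -> 'Hom(g, h)}) (H : 'Hom(g, h)).
Hypothesis defHt : deformation r H Ht.

Lemma polynomial_curve_divX m (P : K -> h) :
  polynomial_curve P -> (forall s, s ^+ m *: P s = 0) -> P 0 = 0.
Proof.
move=> polP sP0; apply: (polynomial_curve_at0 charK polP) => s s_neq0.
by apply: (scalerI (expf_neq0 m s_neq0)); rewrite sP0 scaler0.
Qed.

(** The curvature is alternating, hence so is its coefficient of lowest
    degree. *)
Lemma Ob_I_alt x : Ob_I M Ht x x = 0.
Proof.
rewrite -tail_I0.
apply: (@polynomial_curve_divX n.+1) (polynomial_curve_tail_I _ _ _ _) _ => s.
by rewrite -(curv_I_eval_at defHt) curv_I_alt.
Qed.

Lemma Ob_II_alt x z : Ob_II M Ht x x z = 0.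
Proof.
rewrite -tail_II0.
apply: (@polynomial_curve_divX n.+1) (polynomial_curve_tail_II _ _ _ _ _) _.
by move=> s; rewrite -(curv_II_eval_at defHt) curv_II_alt.
Qed.

(** The twisted coboundary of the tail is a polynomial curve whose value at
    s = 0 is the coboundary of the obstruction, and s^(n+1) times this curve is
    the left-hand side of the Bianchi identity of [eval_at Ht s]. *)
Lemma delta2_I_Ob x1 y1 x2 y2 :
  delta2_I r H (Ob_I M Ht) (Ob_II M Ht) x1 y1 x2 y2 = 0.
Proof.
pose P s := delta2_I r (eval_at Ht s) (tail_I M Ht s) (tail_II M Ht s)
  x1 y1 x2 y2.
have -> : delta2_I r H (Ob_I M Ht) (Ob_II M Ht) x1 y1 x2 y2 = P 0.
  have [<- _ _] := defHt.
  by rewrite /P /delta2_I eval_at0 !(tail_I0, tail_II0).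
apply: (@polynomial_curve_divX n.+1) => [|s]; last first.
  rewrite /P -delta2_IZ -[RHS](bianchi_I r (eval_at Ht s) x1 y1 x2 y2).
  by rewrite /delta2_I !(curv_I_eval_at defHt, curv_II_eval_at defHt).
have pI := polynomial_curve_tail_I M Ht.
have pII := polynomial_curve_tail_II M Ht.
by repeat first [apply: pI | apply: pII | apply: polynomial_curve_rhoH
  | apply: polynomial_curve_DH | apply: polynomial_curveN
  | apply: polynomial_curveD].
Qed.

Lemma delta2_II_Ob x1 y1 x2 y2 z :
  delta2_II r H (Ob_II M Ht) x1 y1 x2 y2 z = 0.
Proof.
pose P s := delta2_II r (eval_at Ht s) (tail_II M Ht s) x1 y1 x2 y2 z.
have -> : delta2_II r H (Ob_II M Ht) x1 y1 x2 y2 z = P 0.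
  have [<- _ _] := defHt.
  by rewrite /P /delta2_II eval_at0 !tail_II0.
apply: (@polynomial_curve_divX n.+1) => [|s]; last first.
  rewrite /P -delta2_IIZ -[RHS](bianchi_II r (eval_at Ht s) x1 y1 x2 y2 z).
  by rewrite /delta2_II !(curv_II_eval_at defHt).
have pII := polynomial_curve_tail_II M Ht.
by repeat first [apply: pII | apply: polynomial_curve_muH
  | apply: polynomial_curve_DH | apply: polynomial_curveN
  | apply: polynomial_curveD].
Qed.

Lemma linear_sum_fun (I : Type) (s : seq I) (A : pred I) (F : I -> g -> h) :
  (forall i, linear (F i)) -> linear (fun x => \sum_(i <- s | A i) F i x).
Proof.
move=> linF a x y; rewrite scaler_sumr -big_split /=.
by apply: eq_bigr => i _; apply: linF.
Qed.

Lemma cochain2_Ob : cochain2 (Ob_I M Ht) (Ob_II M Ht).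
Proof.
split; split; try exact: Ob_I_alt; try exact: Ob_II_alt.
- move=> y; do 2![apply: linear_sum_fun => ?] => a u v.
  by rewrite linearP lfun2D lfun2Z.
- by move=> x; do 2![apply: linear_sum_fun => ?] => a u v; rewrite !linearP.
- move=> y z; do 3![apply: linear_sum_fun => ?] => a u v.
  by rewrite linearP lfun3D1 lfun3Z1.
- move=> x z; do 3![apply: linear_sum_fun => ?] => a u v.
  by rewrite linearP lfun3D2 lfun3Z2.
- by move=> x y; do 3![apply: linear_sum_fun => ?] => a u v; rewrite !linearP.
Qed.

Lemma cocycle2_Ob : cocycle2 r H (Ob_I M Ht) (Ob_II M Ht).
Proof.
by split; [apply: cochain2_Ob | apply: delta2_I_Ob | apply: delta2_II_Ob].
Qed.

End Cocycle.

(** * The coefficient of highest degree of an extension *)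

Section Convolution.
Variables (V : zmodType) (n : nat).
Let w (i : 'I_n.+1) := widen_ord (leqnSn n.+1) i.
Let top := @ord_max n.+1.

Lemma big_ord_recr_cond (P : pred 'I_n.+2) (F : 'I_n.+2 -> V) :
  \sum_(i | P i) F i
  = \sum_(i < n.+1 | P (w i)) F (w i) + (if P top then F top else 0).
Proof. by rewrite big_mkcond big_ord_recr -big_mkcond. Qed.

(** As the total degree is at most n+1 in this lemma and the next three, an
    index n+1 occurs only next to indices 0, and only in degree n+1. *)
Lemma conv2_low (F : 'I_n.+2 -> 'I_n.+2 -> V) (k : nat) : (k <= n)%N ->
  \sum_(i < n.+2) \sum_(j < n.+2 | (i + j == k)%N) F i j
  = \sum_(i < n.+1) \sum_(j < n.+1 | (i + j == k)%N) F (w i) (w j).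
Proof.
move=> le_kn; have no m : (m + n.+1 == k)%N = false.
  by apply/eqP => E; move: le_kn; rewrite -E leqNgt leq_addl.
rewrite big_ord_recr /= [X in _ + X]big_pred0 => [|j]; last by rewrite addnC no.
rewrite addr0; apply: eq_bigr => i _.
by rewrite big_ord_recr_cond /= no addr0.
Qed.

Lemma conv2_top (F : 'I_n.+2 -> 'I_n.+2 -> V) :
  \sum_(i < n.+2) \sum_(j < n.+2 | (i + j == n.+1)%N) F i j
  = \sum_(i < n.+1) \sum_(j < n.+1 | (i + j == n.+1)%N) F (w i) (w j)
    + F ord0 top + F top ord0.
Proof.
have is0 m : (m + n.+1 == n.+1)%N = (m == 0)%N.
  by rewrite -[RHS](eqn_add2r n.+1).
rewrite big_ord_recr /= [X in _ + X = _](big_pred1 ord0) => [|j]; last first.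
  by rewrite addnC is0.
congr (_ + _); under eq_bigr => i _ do rewrite big_ord_recr_cond /= is0.
rewrite big_split /=; congr (_ + _).
rewrite big_ord_recl /= big1 ?addr0 //; congr F; exact: val_inj.
Qed.

Lemma conv3_low (F : 'I_n.+2 -> 'I_n.+2 -> 'I_n.+2 -> V) (k : nat) :
  (k <= n)%N ->
  \sum_(i < n.+2) \sum_(j < n.+2) \sum_(l < n.+2 | (i + j + l == k)%N) F i j l
  = \sum_(i < n.+1) \sum_(j < n.+1) \sum_(l < n.+1 | (i + j + l == k)%N)
      F (w i) (w j) (w l).
Proof.
move=> le_kn; have no m : (m + n.+1 == k)%N = false.
  by apply/eqP => E; move: le_kn; rewrite -E leqNgt leq_addl.
rewrite big_ord_recr /= [X in _ + X]big1 => [|j _]; last first.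
  by rewrite big_pred0 // => l; rewrite -addnA addnC no.
rewrite addr0; apply: eq_bigr => i _.
rewrite big_ord_recr /= [X in _ + X]big_pred0 => [|l]; last first.
  by rewrite addnAC no.
rewrite addr0; apply: eq_bigr => j _.
by rewrite big_ord_recr_cond /= no addr0.
Qed.

Lemma conv3_top (F : 'I_n.+2 -> 'I_n.+2 -> 'I_n.+2 -> V) :
  \sum_(i < n.+2) \sum_(j < n.+2) \sum_(l < n.+2 | (i + j + l == n.+1)%N)
    F i j l
  = \sum_(i < n.+1) \sum_(j < n.+1) \sum_(l < n.+1 | (i + j + l == n.+1)%N)
      F (w i) (w j) (w l)
    + F ord0 ord0 top + F ord0 top ord0 + F top ord0 ord0.
Proof.
have is0 m : (m + n.+1 == n.+1)%N = (m == 0)%N.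
  by rewrite -[RHS](eqn_add2r n.+1).
have w0 : w ord0 = ord0 by apply: val_inj.
rewrite big_ord_recr /=; congr (_ + _); last first.
  rewrite big_ord_recl (big_pred1 ord0) => [|l]; last first.
    by rewrite addn0 addnC is0.
  rewrite big1 ?addr0 // => j _; rewrite big_pred0 // => l.
  by rewrite -addnA addnC is0.
under eq_bigr => i _ do rewrite big_ord_recr /=.
rewrite big_split /=; congr (_ + _); last first.
  rewrite big_ord_recl [X in _ + X]big1 => [|i _]; last first.
    by rewrite big_pred0 // => l; rewrite addnAC is0.
  rewrite addr0 (big_pred1 ord0) => [|l]; last by rewrite addnAC is0.
  by rewrite -w0.
under eq_bigr => i _ do under eq_bigr => j _ do
  rewrite big_ord_recr_cond /= is0.
under eq_bigr => i _ do rewrite big_split /=.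
rewrite big_split /=; congr (_ + _).
rewrite big_ord_recl [X in _ + X]big1 => [|i _]; last first.
  by rewrite big1.
rewrite addr0 big_ord_recl big1 // addr0 /=.
by rewrite -w0.
Qed.

End Convolution.

Section Extension.
Variables (K : fieldType) (g h : vectType K).
Variables (L : lieYamaguti g) (M : lieYamaguti h) (r : action L M).
Variables (n : nat) (Ht : {ffun 'I_n.+1 -> 'Hom(g, h)}) (f : 'Hom(g, h)).

Lemma add_top_widen i : add_top Ht f (widen_ord (leqnSn n.+1) i) = Ht i.
Proof.
rewrite ffunE; have -> : widen_ord (leqnSn n.+1) i = lift ord_max i.
  by apply: val_inj; rewrite /= /bump leqNgt ltn_ord.
by rewrite liftK.
Qed.

Lemma add_top_max : add_top Ht f ord_max = f.
Proof. by rewrite ffunE unlift_none. Qed.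

Lemma add_top0 : add_top Ht f ord0 = Ht ord0.
Proof.
by rewrite -(add_top_widen ord0); congr (add_top Ht f _); apply: val_inj.
Qed.

Lemma tapp_add_top_widen x i :
  tapp (add_top Ht f) x (widen_ord (leqnSn n.+1) i) = Ht i x.
Proof. by rewrite ffunE add_top_widen. Qed.

Lemma tapp_add_top_max x : tapp (add_top Ht f) x ord_max = f x.
Proof. by rewrite ffunE add_top_max. Qed.

Lemma tapp_add_top0 x : tapp (add_top Ht f) x ord0 = Ht ord0 x.
Proof. by rewrite ffunE add_top0. Qed.

Lemma ext2_add_top_widen x y i :
  ext2 (br M) (tapp (add_top Ht f) x) (tapp (add_top Ht f) y)
    (widen_ord (leqnSn n.+1) i)
  = ext2 (br M) (tapp Ht x) (tapp Ht y) i.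
Proof.
rewrite [LHS]ffunE [RHS]ffunE conv2_low /=; last by rewrite -ltnS.
apply: eq_bigr => j _; apply: eq_bigr => k _.
by rewrite !tapp_add_top_widen !ffunE.
Qed.

Lemma ext3_add_top_widen x y z i :
  ext3 (tbr M) (tapp (add_top Ht f) x) (tapp (add_top Ht f) y)
    (tapp (add_top Ht f) z) (widen_ord (leqnSn n.+1) i)
  = ext3 (tbr M) (tapp Ht x) (tapp Ht y) (tapp Ht z) i.
Proof.
rewrite [LHS]ffunE [RHS]ffunE conv3_low /=; last by rewrite -ltnS.
apply: eq_bigr => j _; apply: eq_bigr => k _; apply: eq_bigr => l _.
by rewrite !tapp_add_top_widen !ffunE.
Qed.

Lemma ext2_add_top_max x y :
  ext2 (br M) (tapp (add_top Ht f) x) (tapp (add_top Ht f) y) ord_max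
  = Ob_I M Ht x y + br M (Ht ord0 x) (f y) + br M (f x) (Ht ord0 y).
Proof.
rewrite ffunE conv2_top !tapp_add_top_max !tapp_add_top0; congr (_ + _ + _).
rewrite -tail_I0 /tail_I sum_expr0_degree.
rewrite -(sum_deg2 (fun i j => br M (Ht i x) (Ht j y))).
by apply: eq_bigr => j _; apply: eq_bigr => k _; rewrite !tapp_add_top_widen.
Qed.

Lemma ext3_add_top_max x y z :
  ext3 (tbr M) (tapp (add_top Ht f) x) (tapp (add_top Ht f) y)
    (tapp (add_top Ht f) z) ord_max
  = Ob_II M Ht x y z + tbr M (Ht ord0 x) (Ht ord0 y) (f z)
    + tbr M (Ht ord0 x) (f y) (Ht ord0 z)
    + tbr M (f x) (Ht ord0 y) (Ht ord0 z).
Proof.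
rewrite ffunE conv3_top !tapp_add_top_max !tapp_add_top0; congr (_ + _ + _ + _).
apply: eq_bigr => j _; apply: eq_bigr => k _; apply: eq_bigr => l _.
by rewrite !tapp_add_top_widen.
Qed.

Lemma ext1_coef_I m (a b : 'End(h)) (u v w : trunc m h) i :
  (ext1 a u - ext1 b v + w) i = a (u i) - b (v i) + w i.
Proof. by rewrite !ffunE. Qed.

Lemma ext1_coef_II m (a b c : 'End(h)) (u v w t : trunc m h) i :
  (ext1 a u + ext1 b v - ext1 c w + t) i = a (u i) + b (v i) - c (w i) + t i.
Proof. by rewrite !ffunE. Qed.

(** Adding a term of degree n+1 leaves the equations of degree at most n
    unchanged. In the equation of degree n+1 it can meet only indices 0, that is
    H itself, so it enters linearly, through the coboundary twisted by H. *)
Lemma deformation_add_top H : deformation r H Ht ->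
  deformation r H (add_top Ht f) <->
  (forall x y, Ob_I M Ht x y = - delta1_I r H f x y) /\
  (forall x y z, Ob_II M Ht x y z = - delta1_II r H f x y z).
Proof.
move=> [H0 eqI eqII].
have topI x y : (Ob_I M Ht x y = - delta1_I r H f x y) <->
  f (br L x y) = rho r x (f y) - rho r y (f x)
    + (Ob_I M Ht x y + br M (Ht ord0 x) (f y) + br M (f x) (Ht ord0 y)).
  rewrite H0 (brC M (f x)) /delta1_I /rhoH; split=> ->; linear_ring.
have topII x y z : (Ob_II M Ht x y z = - delta1_II r H f x y z) <->
  f (tbr L x y z) = Drep r x y (f z) + mu r y z (f x) - mu r x z (f y)
    + (Ob_II M Ht x y z + tbr M (Ht ord0 x) (Ht ord0 y) (f z)
    + tbr M (Ht ord0 x) (f y) (Ht ord0 z)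
    + tbr M (f x) (Ht ord0 y) (Ht ord0 z)).
  rewrite H0 (tbrC M (H x) (f y)) /delta1_II /DH /muH; split=> ->; linear_ring.
have ordP (P : 'I_n.+2 -> Prop) :
    (forall i : 'I_n.+1, P (widen_ord (leqnSn n.+1) i)) -> P ord_max ->
    forall i, P i.
  move=> Pw Pm i; case: (unliftP ord_max i) => [j ->|-> //].
  have <- : widen_ord (leqnSn n.+1) j = lift ord_max j; last exact: Pw.
  by apply: val_inj; rewrite /= /bump leqNgt ltn_ord.
split=> [[_ eqI' eqII'] | [obI obII]].
  split=> [x y | x y z].
    by apply/topI; rewrite -ext2_add_top_max -!tapp_add_top_max;
      rewrite eqI' ext1_coef_I.
  by apply/topII; rewrite -ext3_add_top_max -!tapp_add_top_max;
    rewrite eqII' ext1_coef_II.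
split; first by rewrite add_top0.
  move=> x y; apply/ffunP; apply: ordP => [i|]; rewrite ext1_coef_I.
    have /ffunP/(_ i) := eqI x y.
    by rewrite ext2_add_top_widen !tapp_add_top_widen ext1_coef_I !ffunE.
  by rewrite ext2_add_top_max !tapp_add_top_max; apply/topI.
move=> x y z; apply/ffunP; apply: ordP => [i|]; rewrite ext1_coef_II.
  have /ffunP/(_ i) := eqII x y z.
  by rewrite ext3_add_top_widen !tapp_add_top_widen ext1_coef_II !ffunE.
by rewrite ext3_add_top_max !tapp_add_top_max; apply/topII.
Qed.

End Extension.

Theorem theorem5p15 (K : fieldType) (charK : [pchar K] =i pred0)
    (g h : vectType K) (L : lieYamaguti g) (M : lieYamaguti h)
    (r : action L M) (H : 'Hom(g, h)) (HH : crossed_hom r H)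
    (n : nat) (n_ge1 : (1 <= n)%N)
    (Ht : {ffun 'I_n.+1 -> 'Hom(g, h)}) (defHt : deformation r H Ht) :
  cocycle2 r H (Ob_I M Ht) (Ob_II M Ht) /\
  (extendable r H Ht <-> coboundary2 r H (Ob_I M Ht) (Ob_II M Ht)).
Proof.
split; first exact: cocycle2_Ob.
have delta1_IN f x y : delta1_I r H (- f) x y = - delta1_I r H f x y.
  rewrite /delta1_I /rhoH !opp_lfunE.
  rewrite !(linearN (br M _)) !(linearN (rho r _)) /=.
  linear_ring.
have delta1_IIN f x y z : delta1_II r H (- f) x y z = - delta1_II r H f x y z.
  rewrite /delta1_II /DH /muH !opp_lfunE !lfun3N1 !linearN /=; linear_ring.
(* An extension by f makes Ob the coboundary of - f, and conversely. *)
split=> [[f /(deformation_add_top f defHt)[obI obII]] | [f [obI obII]]].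
  by exists (- f); split=> *; rewrite ?delta1_IN ?delta1_IIN.
exists (- f); apply/(deformation_add_top _ defHt).
by split=> *; rewrite ?delta1_IN ?delta1_IIN opprK.
Qed.
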